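(* For any positive $k$ and $d$ large enough such that $k\ll d$ with $k\le d/4$, there exists a ReLU generative network $G:\mathbb R^{k+1}\to\mathbb R^d$ (without offsets), with a $(k+1)$-dimensional input and depth $n=3$, such that for the quantized linear model $y=\mathrm{sign}(\langle a,\theta_0\rangle+\xi+\tau)$, where $\theta_0\in G(\mathbb R^{k+1})\cap\mathbb B_2^d(1)$, $\xi\sim\mathcal N(0,1)$, $a\sim\mathcal N(0,\mathbf I_d)$ and $m\ge c_1k\log(d/k)$, we have $$\inf_{\widehat\theta}\ \sup_{\theta_0\in G(\mathbb R^{k+1})\cap\mathbb B_2^d(1)}\mathbb E\|\widehat\theta-\theta_0\|_2\ \ge\ c_2\sqrt{\frac{k\log(d/k)}{m}},$$ where $c_1,c_2>0$ are absolute constants and the infimum is taken over all estimators $\widehat\theta$ generated by all possible algorithms depending on $m$ i.i.d. copies $(a_i,y_i)_{i=1}^m$ of $(a,y)$.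
   Context: A ReLU network of depth $n=3$ (without offsets) is a map of the form $G(x)=\sigma\circ(W_3\,\sigma\circ(W_2\,\sigma\circ(W_1x)))$, where $\sigma(t)=\max\{t,0\}$ is applied entrywise and $W_i\in\mathbb R^{d_i\times d_{i-1}}$ with $d_0=k+1$, $d_3=d$ and $d_i\le d$ for $i=1,2,3$. $\mathbb B_2^d(1)$ is the Euclidean unit ball of $\mathbb R^d$ centered at the origin. $\tau$ is the dithering noise (random quantization threshold) added before taking the sign, $\tau\sim\mathrm{Unif}[-\lambda,\lambda]$ for a chosen parameter $\lambda>0$. *)

(* Defs.v *)
From HB Require Import structures.
From mathcomp Require Import all_boot all_order all_algebra.
From mathcomp Require Import all_classical all_reals all_analysis.
Set Implicit Arguments.
Unset Strict Implicit.
Unset Printing Implicit Defensive.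
Import Order.TTheory GRing.Theory Num.Theory.
Import numFieldNormedType.Exports.
Local Open Scope classical_set_scope.
Local Open Scope ring_scope.

Section iid.
Context {d : measure_display} {T : measurableType d} {R : realType}.

Definition tcons n (x : T * n.-tuple T) : n.+1.-tuple T :=
  [tuple of x.1 :: x.2].

Lemma measurable_tcons n : measurable_fun setT (@tcons n).
Proof. exact: measurable_cons. Qed.

HB.instance Definition _ n :=
  isMeasurableFun.Build _ _ _ _ (@tcons n) (@measurable_tcons n).

(* n-fold product of P on n.-tuple T; iid_probE below is its characteristic
   property. *)
Fixpoint iid_prob (P : probability T R) n : probability (n.-tuple T) R :=
  match n with
  | 0%N => dirac [tuple]
  | n'.+1 => distribution (P \x iid_prob P n')%E (@tcons n')
  end.

Lemma iid_probE (P : probability T R) n (A : 'I_n -> set T) :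
  (forall i, measurable (A i)) ->
  iid_prob P n [set t | forall i, A i (tnth t i)] = (\prod_(i < n) P (A i))%E.
Proof.
elim: n A => [|n IHn] A mA /=.
  rewrite big_ord0 diracE mem_set//= => i; by case: i.
rewrite /distribution /pushforward big_ord_recl -IHn//.
rewrite -product_measure1E//; last first.
  rewrite [X in measurable X](_ : _ =
    \bigcap_(i in [set: 'I_n]) ((@tnth n T)^~ i @^-1` A (lift ord0 i))).
    apply: fin_bigcap_measurable => // i _.
    rewrite -[X in measurable X]setTI.
    exact: measurable_tnth.
  by apply/seteqP; split=> t /= H i; [move=> _|]; exact: H.
congr (_ _); apply/seteqP; split=> -[x t] /=.
  move=> H; split=> /=; first exact: (H ord0).
  by move=> i; have := H (lift ord0 i); rewrite tnthS.
move=> [H0 H] i; case: (unliftP ord0 i) => [j ->|->//].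
by rewrite tnthS; exact: H.
Qed.

End iid.

Section relu_network.
Context {R : realType}.

Definition relu (t : R) : R := Num.max t 0.

Definition relu_layer p q (W : 'M[R]_(q, p)) (x : 'cV[R]_p) : 'cV[R]_q :=
  map_mx relu (W *m x).

Definition relu_network3 p d (G : 'cV[R]_p -> 'cV[R]_d) : Prop :=
  exists (d1 d2 : nat) (W1 : 'M[R]_(d1, p)) (W2 : 'M[R]_(d2, d1))
    (W3 : 'M[R]_(d, d2)),
  [/\ (d1 <= d)%N, (d2 <= d)%N &
      forall x, G x = relu_layer W3 (relu_layer W2 (relu_layer W1 x))].

End relu_network.

Section quantized_model.
Context {R : realType}.
Local Notation mR := (measurableTypeR R).

(* The norm of the library on matrices is the sup norm. *)
Definition norm2 d (v : 'cV[R]_d) : R := Num.sqrt (\sum_(i < d) v i 0 ^+ 2).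

Definition unit_ball2 d : set 'cV[R]_d := [set v | norm2 v <= 1].

Definition inner d (a : d.-tuple mR) (v : 'cV[R]_d) : R :=
  \sum_(i < d) tnth a i * v i 0.

(* Joint law of the independent triple (a, xi, tau). *)
Definition noise_prob d (lambda : R) (lambda0 : 0 < lambda) :
    probability (d.-tuple mR * mR * mR)%type R :=
  (iid_prob (normal_prob 0 1) d \x normal_prob 0 1
     \x uniform_prob (gtrN lambda0))%E.

(* The observation (a, y) under the parameter theta; Num.sg 0 = 0, but its
   argument vanishes with probability 0. *)
Definition observe d (theta : 'cV[R]_d) (w : d.-tuple mR * mR * mR) :
    d.-tuple mR * mR :=
  let: (a, xi, tau) := w in (a, Num.sg (inner a theta + xi + tau)).

Definition observations d m (theta : 'cV[R]_d)
    (w : m.-tuple (d.-tuple mR * mR * mR)) : m.-tuple (d.-tuple mR * mR) :=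
  [tuple observe theta (tnth w i) | i < m].

(* Coordinatewise measurability is Borel measurability into R^d. *)
Definition estimator d m : set (m.-tuple (d.-tuple mR * mR) -> 'cV[R]_d) :=
  [set est | forall i, measurable_fun setT (fun s => est s i 0 : mR)].

Definition risk d m (lambda : R) (lambda0 : 0 < lambda)
    (est : m.-tuple (d.-tuple mR * mR) -> 'cV[R]_d) (theta : 'cV[R]_d) :
    \bar R :=
  (\int[iid_prob (noise_prob d lambda0) m]_w
     (norm2 (est (observations theta w) - theta))%:E)%E.

Definition minimax_risk d m (lambda : R) (lambda0 : 0 < lambda)
    (Theta : set 'cV[R]_d) : \bar R :=
  ereal_inf [set ereal_sup [set risk lambda0 est theta | theta in Theta]
            | est in @estimator d m].

End quantized_model.

(* Main.v *)
(** The range of the network contains all the block-sparse vectors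
  [b * \sum_j e_(pos j (I j))], with [I] ranging over [q]^k, q = d/k - 2 and
  b > 0 arbitrary: without offsets, an extra input proportional to b provides
  the breakpoints of the tent functions that select one coordinate per block.

  Estimating such a vector amounts to k problems of testing between q
  hypotheses (Assouad's reduction).  Adding b e_i to the parameter has the same
  effect on the observations as replacing the Gaussian noise xi by
  xi + b <a, e_i>, so by data processing the chi-square divergence of m
  observations is at most exp(2 b^2 m), whatever the dithering.  By
  Cauchy-Schwarz each block is then decoded with average probability at most
  sqrt(exp(2 b^2 m) / q), which is bounded away from 1 when b^2 is of order
  log(d/k) / m. *)

Require Import Defs.
From HB Require Import structures.
From mathcomp Require Import all_boot all_order all_algebra.
From mathcomp Require Import all_classical all_reals all_analysis.
From mathcomp Require Import measurable_realfun ring lra zify.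
Set Implicit Arguments.
Unset Strict Implicit.
Unset Printing Implicit Defensive.
Import Order.TTheory GRing.Theory Num.Theory.
Import numFieldNormedType.Exports.
Local Open Scope classical_set_scope.
Local Open Scope ring_scope.

(** * Cauchy-Schwarz for extended-real functions *)

Section cauchy_schwarz.
Context d (T : measurableType d) (R : realType) (P : {measure set T -> \bar R}).
Local Open Scope ereal_scope.

(** Arithmetic-geometric mean: the square of [t * u + t^-1 * g] exceeds that of [t * u - t^-1 * g]
    by [4 * u * g], hence is at least [(h + h) ^+ 2]. *)
Let amgm (t u : R) (g h : \bar R) : (0 < t)%R -> (0 <= u)%R -> 0 <= g -> 0 <= h ->
  h * h <= u%:E * g -> h + h <= t%:E * u%:E + t^-1%:E * g.
Proof.
move=> t0 u0; case: g => [g| |//]; last first.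
  by move=> _ _ _; rewrite gt0_muley ?lte_fin ?invr_gt0// addey ?leey.
case: h => [h| |//]; last by rewrite mulyy leye_eq.
rewrite -!EFinM -!EFinD !lee_fin => g0 h0 hug.
have ti0 : (0 < t^-1)%R by rewrite invr_gt0.
have tt : (t * t^-1 = 1)%R by rewrite divff ?gt_eqF.
have htg : (0 <= t * u + t^-1 * g)%R by rewrite addr_ge0// mulr_ge0// ltW.
rewrite -(@ler_pXn2r _ 2)// ?nnegrE ?addr_ge0//.
have E : ((t * u + t^-1 * g) ^+ 2 =
          (t * u - t^-1 * g) ^+ 2 + 4 * (t * t^-1) * (u * g))%R by ring.
rewrite E tt.
by have := sqr_ge0 (t * u - t^-1 * g)%R; nra.
Qed.

(** The pointwise bound [amgm] is linear in [u] and [g], so it can be integrated for each fixed [t]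
    without any integrability assumption; optimising over [t] afterwards restores the product
    form. *)
Lemma integral_sqr_le (u : T -> R) (g h : T -> \bar R) (C : R) :
  (0 < C)%R -> measurable_fun setT u -> measurable_fun setT g ->
  measurable_fun setT h ->
  (forall x, (0 <= u x)%R) -> (forall x, 0 <= g x) -> (forall x, 0 <= h x) ->
  (forall x, h x * h x <= (u x)%:E * g x) ->
  \int[P]_x (u x)%:E <= C%:E ->
  (\int[P]_x h x) * (\int[P]_x h x) <= C%:E * \int[P]_x g x.
Proof.
move=> C0 mu mg mh u0 g0 h0 hug intu.
have key (t : R) : (0 < t)%R ->
    \int[P]_x h x + \int[P]_x h x <= t%:E * C%:E + t^-1%:E * \int[P]_x g x.
  move=> t0; have ti0 : (0 < t^-1)%R by rewrite invr_gt0.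
  rewrite -ge0_integralD//.
  apply: (@le_trans _ _
      (\int[P]_x (t%:E * (u x)%:E + t^-1%:E * g x))).
    apply: ge0_le_integral => //.
    - by move=> x _; rewrite adde_ge0.
    - exact: emeasurable_funD.
    - apply: emeasurable_funD; apply: measurable_funeM => //.
      exact/measurable_EFinP.
    - by move=> x _; exact: amgm.
  have mtu : measurable_fun setT (fun x => t%:E * (u x)%:E).
    by apply: measurable_funeM; exact/measurable_EFinP.
  have mtg : measurable_fun setT (fun x => t^-1%:E * g x).
    exact: measurable_funeM.
  have tu0 x : 0 <= t%:E * (u x)%:E by rewrite mule_ge0 ?lee_fin// ltW.
  have tg0 x : 0 <= t^-1%:E * g x by rewrite mule_ge0 ?lee_fin// ltW.
  have mu' : measurable_fun setT (EFin \o u) by exact/measurable_EFinP.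
  have u0' x : setT x -> 0 <= (u x)%:E by rewrite lee_fin.
  have [t0' ti0'] := (ltW t0, ltW ti0).
  rewrite ge0_integralD// !ge0_integralZl//.
  by rewrite leeD2r// lee_pmul2l// lte_fin.
have H0 : 0 <= \int[P]_x h x by apply: integral_ge0.
have G0 : 0 <= \int[P]_x g x by apply: integral_ge0.
move: key H0 G0.
case: (\int[P]_x g x) => [G| |//]; last by move=> _ _ _; rewrite gt0_muley ?lte_fin// leey.
case: (\int[P]_x h x) => [H| |//]; last first.
  by move=> /(_ 1%R ltr01) + _ _; rewrite -!EFinM -EFinD addye// leye_eq.
move=> key; rewrite -!EFinM !lee_fin => H0 G0.
have [->|Hn0] := eqVneq H 0%R; first by rewrite mul0r mulr_ge0// ltW.
have Hp : (0 < H)%R by rewrite lt_neqAle eq_sym Hn0.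
(* At [t = H / C] the first term [t * C] is [H], which cancels one of the two copies on the left and
   leaves [H <= C / H * G]. *)
have := key (H / C)%R (divr_gt0 Hp C0).
rewrite -!EFinM -!EFinD lee_fin divfK ?gt_eqF// invf_div lerD2l.
by rewrite mulrAC ler_pdivlMr.
Qed.

End cauchy_schwarz.

(** * Translates and exponential moments of the standard Gaussian *)

Section gaussian_shift.
Context {R : realType}.
Local Notation mR := (measurableTypeR R).
Local Notation mu := (@lebesgue_measure R).
Local Notation gauss := (normal_prob (0 : R) 1).
Local Notation phi := (normal_pdf (0 : R) 1).
Local Open Scope ereal_scope.

(** The Radon-Nikodym derivative of [nu] and [g] have the same integral over every measurable set,
    so they agree [la]-almost everywhere. *)
Lemma integral_density d (T : measurableType d)
    (nu : {finite_measure set T -> \bar R})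
    (la : {sigma_finite_measure set T -> \bar R}) (g : T -> R) (f : T -> \bar R) :
  la.-integrable setT (EFin \o g) -> nu `<< la ->
  (forall A, measurable A -> nu A = \int[la]_(x in A) (g x)%:E) ->
  measurable_fun setT f -> (forall x, 0 <= f x) ->
  \int[nu]_x f x = \int[la]_x (f x * (g x)%:E).
Proof.
move=> ig nula nuE mf f0.
rewrite -(Radon_Nikodym_SigmaFinite.change_of_variables nula f0 measurableT mf).
have irn := Radon_Nikodym_SigmaFinite.f_integrable nula.
apply: ae_eq_integral => //.
- by apply: emeasurable_funM => //; exact: measurable_int irn.
- by apply: emeasurable_funM => //; exact: measurable_int ig.
apply: ae_eqe_mul2l; apply: integral_ae_eq => //.
- exact: measurable_int ig.
- by move=> A _ mA; rewrite -Radon_Nikodym_SigmaFinite.f_integral// nuE.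
Qed.

Lemma lebesgue_measure_shift (s : R) (A : set mR) : measurable A ->
  pushforward mu (fun x : mR => (x + s)%R : mR) A = mu A.
Proof.
move=> mA; apply/esym.
have ms : measurable_fun setT (fun x : mR => (x + s)%R : mR).
  exact: measurable_funD.
apply: (@lebesgue_measure_unique _ (pushforward mu (fun x : mR => (x + s)%R : mR))) => //.
move=> _ [[a b]] _ <-.
transitivity (mu `](a - s)%R, (b - s)%R]%classic); last first.
  congr (mu _); apply/seteqP; split=> x /=;
    by rewrite !in_itv/= ltrBlDr lerBrDr.
rewrite !lebesgue_measure_itv/= !lte_fin ltrD2r; case: ifP => // _.
by rewrite -!EFinD; congr EFin; ring.
Qed.

Lemma integral_lebesgue_shift (s : R) (f : mR -> \bar R) :
  measurable_fun setT f -> (forall x, 0 <= f x) ->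
  \int[mu]_x f (x + s)%R = \int[mu]_x f x.
Proof.
move=> mf f0.
have ms : measurable_fun setT (fun x : mR => (x + s)%R : mR).
  exact: measurable_funD.
rewrite -[RHS](@eq_measure_integral _ _ _ _ mu
    (pushforward mu (fun x : mR => (x + s)%R : mR))); last first.
  by move=> A mA _; exact: lebesgue_measure_shift.
by rewrite ge0_integral_pushforward// preimage_setT.
Qed.

Lemma integral_gauss (f : mR -> \bar R) :
  measurable_fun setT f -> (forall x, 0 <= f x) ->
  \int[gauss]_x f x = \int[mu]_x (f x * (phi x)%:E).
Proof.
move=> mf f0; apply: integral_density => //.
- exact: integrable_normal_pdf.
- exact: normal_prob_dominates.
Qed.

Lemma normal_pdf_shift (s x : R) :
  (phi (x - s) = expR (s * x - s ^+ 2 / 2) * phi x)%R.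
Proof.
rewrite normal_pdfE ?oner_eq0// /normal_fun mulrCA -expRD.
by congr (_ * expR _)%R; field.
Qed.

(** Cameron-Martin formula: by translation invariance of Lebesgue measure the shifted law has
    likelihood ratio [phi (x - s) / phi x], the exponential on the right. *)
Lemma integral_gauss_shift (s : R) (f : mR -> \bar R) :
  measurable_fun setT f -> (forall x, 0 <= f x) ->
  \int[gauss]_x f (x + s)%R =
  \int[gauss]_x (f x * (expR (s * x - s ^+ 2 / 2))%:E).
Proof.
move=> mf f0.
have ms : measurable_fun setT (fun x : mR => (x + s)%R : mR).
  exact: measurable_funD.
have mp := measurable_normal_pdf (0 : R) 1.
have p0 := normal_pdf_ge0 (0 : R) 1.
have me : measurable_fun setT (fun x : mR => expR (s * x - s ^+ 2 / 2) : mR).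
  by apply: measurableT_comp => //; apply: measurable_funB => //;
    exact: measurable_funM.
have mL : measurable_fun setT (fun x : mR => f x * (expR (s * x - s ^+ 2 / 2))%:E).
  by apply: emeasurable_funM => //; exact/measurable_EFinP.
have L0 x : 0 <= f x * (expR (s * x - s ^+ 2 / 2))%:E.
  by rewrite mule_ge0// lee_fin expR_ge0.
have mfs : measurable_fun setT (fun x : mR => f (x + s)%R).
  exact: measurableT_comp.
rewrite !integral_gauss// -[RHS](integral_lebesgue_shift s).
- apply: eq_integral => x _.
  by rewrite -muleA -EFinM -normal_pdf_shift addrK.
- by apply: emeasurable_funM => //; exact/measurable_EFinP.
- by move=> x; rewrite mule_ge0// lee_fin.
Qed.

Lemma integral_gauss_expR (s : R) :
  \int[gauss]_x (expR (s * x - s ^+ 2 / 2))%:E = 1.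
Proof.
have := @integral_gauss_shift s (cst 1) (measurable_cst _) (fun=> lee01).
rewrite integral_cst// mul1e => H; rewrite -[RHS](_ : gauss setT = 1).
  by rewrite H; apply: eq_integral => x _; rewrite mul1e.
exact: (@probability_setT _ _ _ (normal_prob (0 : R) 1)).
Qed.

(** Multiplying [phi] by [expR (c * x ^+ 2)] gives [s] times the centred normal density of variance
    [s ^+ 2 = (1 - 2 * c)^-1], so the integral is exactly [s]. *)
Lemma integral_gauss_expR_sqr (c : R) : (0 <= c <= 4^-1)%R ->
  \int[gauss]_x (expR (c * x ^+ 2))%:E <= (expR (2 * c))%:E.
Proof.
move=> /andP[c0 c4].
pose v : R := (1 - 2 * c)%R.
have v0 : (0 < v)%R by rewrite /v; lra.
pose s : R := (Num.sqrt v^-1)%R.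
have s0 : (0 < s)%R by rewrite sqrtr_gt0 invr_gt0.
have s2 : (s ^+ 2 = v^-1)%R by rewrite sqr_sqrtr// invr_ge0 ltW.
have sn0 : s != 0%R by rewrite gt_eqF.
have mp := measurable_normal_pdf (0 : R) s.
have me : measurable_fun setT (fun x : mR => (expR (c * x ^+ 2))%:E).
  apply/measurable_EFinP; apply: measurableT_comp => //.
  by apply: measurable_funM => //; exact: measurable_funX.
rewrite integral_gauss//.
rewrite (eq_integral (fun x : mR => s%:E * (normal_pdf 0 s x)%:E)); last first.
  move=> x _; rewrite -!EFinM; congr EFin.
  rewrite !normal_pdfE ?oner_eq0// /normal_peak /normal_fun s2.
  rewrite expr1n mul1r mulrCA -expRD [RHS]mulrA; congr (_ * expR _)%R.
    rewrite -mulrnAr sqrtrM ?invr_ge0 ?ltW// -/s invfM mulrA divff// mul1r.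
    by [].
  by rewrite /v; field; rewrite -/v gt_eqF.
have mE : measurable_fun setT (fun x : mR => (normal_pdf 0 s x)%:E).
  exact/measurable_EFinP.
rewrite ge0_integralZl ?lee_fin ?(ltW s0)//; last first.
  by move=> x _; rewrite lee_fin normal_pdf_ge0.
rewrite integral_normal_pdf mule1 lee_fin.
rewrite -(@ler_pXn2r _ 2)// ?nnegrE ?expR_ge0 ?(ltW s0)// s2 -expRM_natl.
rewrite -[leRHS]invrK lef_pV2 ?posrE ?invr_gt0 ?expR_gt0//.
rewrite -[leLHS]mul1r ler_pdivrMr ?expR_gt0//.
(* [(1 - 2c)(1 + 4c) = 1 + 2c(1 - 4c)] is at least 1 exactly because [0 <= c <= 1/4]. *)
apply: (@le_trans _ _ (v * (1 + 2 * (2 * c)))%R).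
  by rewrite /v; nra.
by rewrite ler_wpM2l ?expR_ge1Dx// ltW.
Qed.

End gaussian_shift.

(** * Chi-square bounds: tensorization and Gaussian shears *)

Section chi_square.
Local Open Scope ereal_scope.

(* By duality, the chi-square divergence from P of the image of P under T is at
   most C - 1. *)
Definition chi2_le d (X : measurableType d) (R : realType)
    (P : {measure set X -> \bar R}) (T : X -> X) (C : R) : Prop :=
  forall f : X -> \bar R, measurable_fun setT f -> (forall x, 0 <= f x) ->
  (\int[P]_x f (T x)) * (\int[P]_x f (T x)) <= C%:E * \int[P]_x (f x * f x).

Lemma chi2_le_id d (X : measurableType d) (R : realType)
  (P : probability X R) : chi2_le P id 1.
Proof.
move=> f mf f0; apply: (@integral_sqr_le _ _ _ _ (cst 1%R)) => //.
- exact: emeasurable_funM.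
- by move=> x; rewrite mule_ge0.
- by move=> x; rewrite mul1e.
- by rewrite -[leLHS]/(\int[P]_x cst 1 x) integral_cst// mul1e probability_le1.
Qed.

Section product.
Context d1 d2 (X : measurableType d1) (Y : measurableType d2) (R : realType).
Variables (P : probability X R) (Q : probability Y R).

Lemma measurable_integral_section (k : X * Y -> \bar R) :
  measurable_fun setT k -> (forall z, 0 <= k z) ->
  measurable_fun setT (fun x => \int[Q]_y k (x, y)).
Proof. exact: (@measurable_fun_fubini_tonelli_F _ _ X Y R Q). Qed.

(** Tensorization: the bound for [P] is applied to the partial integral [g x] of [f (x, T y)] over
    [Q], then the bound for [Q] to each section [f (x, _)]. *)
Lemma chi2_le_prod (S : X -> X) (T : Y -> Y) (C D : R) :
  measurable_fun setT S -> measurable_fun setT T -> (0 <= C)%R -> (0 <= D)%R ->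
  chi2_le P S C -> chi2_le Q T D ->
  chi2_le (P \x Q) (fun z => (S z.1, T z.2)) (C * D).
Proof.
move=> mS mT C0 D0 PS QT f mf f0.
pose k (z : X * Y) := f (z.1, T z.2).
have mk : measurable_fun setT k.
  apply: measurableT_comp => //; apply/measurable_fun_pair => //=.
  exact: measurableT_comp.
have k0 z : 0 <= k z by exact: f0.
have mST : measurable_fun setT (fun z => f (S z.1, T z.2)).
  by apply: measurableT_comp => //; apply/measurable_fun_pair => //=;
    exact: measurableT_comp.
have mff : measurable_fun setT (fun z => f z * f z) by exact: emeasurable_funM.
have ff0 z : 0 <= f z * f z by rewrite mule_ge0.
pose g x := \int[Q]_y k (x, y).
have mg : measurable_fun setT g by exact: measurable_integral_section.
have g0 x : 0 <= g x by apply: integral_ge0.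
rewrite !fubini_tonelli1//; apply: (le_trans (PS g mg g0)).
rewrite EFinM -muleA lee_wpmul2l// ?lee_fin//.
rewrite -ge0_integralZl//; first last.
- by move=> x _; apply: integral_ge0.
- exact: measurable_integral_section.
apply: ge0_le_integral => //.
- by move=> x _; rewrite mule_ge0.
- exact: emeasurable_funM.
- by apply: measurable_funeM; exact: measurable_integral_section.
- move=> x _; apply: (QT (fun y => f (x, y))) => //.
  by apply: measurableT_comp => //; exact: pair1_measurable.
Qed.

End product.

Section iid.
Context d (X : measurableType d) (R : realType) (P : probability X R).

Lemma integral_iid_probS n (f : n.+1.-tuple X -> \bar R) :
  measurable_fun setT f -> (forall t, 0 <= f t) ->
  \int[iid_prob P n.+1]_t f t = \int[P \x iid_prob P n]_z f (tcons z).
Proof. by move=> mf f0; rewrite /= /distribution ge0_integral_pushforward. Qed.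

Lemma measurable_map_tuple n (T : X -> X) : measurable_fun setT T ->
  measurable_fun setT (@map_tuple n _ _ T).
Proof.
move=> mT; apply/measurable_fun_tnthP => i.
rewrite (_ : _ \o _ = T \o (@tnth n X ^~ i)); last first.
  by apply/funext => t /=; rewrite tnth_map.
by apply: measurableT_comp => //; exact: measurable_tnth.
Qed.

Lemma chi2_le_iid (T : X -> X) (C : R) n :
  measurable_fun setT T -> (0 <= C)%R -> chi2_le P T C ->
  chi2_le (iid_prob P n) (map_tuple T) (C ^+ n)%R.
Proof.
move=> mT C0 PT; elim: n => [|n IH] f mf f0.
  have mfT : measurable_fun setT (fun x : 0.-tuple X => f (map_tuple T x)).
    by apply: measurableT_comp => //; exact: measurable_map_tuple.
  rewrite /= !integral_dirac//; last exact: emeasurable_funM.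
  by rewrite diracE mem_setT !mul1e (tuple0 (map_tuple _ _)).
have mfT : measurable_fun setT (fun x : n.+1.-tuple X => f (map_tuple T x)).
  by apply: measurableT_comp => //; exact: measurable_map_tuple.
rewrite !integral_iid_probS//; first last.
- by move=> t; rewrite mule_ge0.
- exact: emeasurable_funM.
have tT z : map_tuple T (tcons z) =
    tcons (T z.1, map_tuple T z.2) :> n.+1.-tuple X by exact/val_inj.
under eq_integral do rewrite tT.
rewrite exprS; apply: (chi2_le_prod mT _ C0 _ PT IH (f := f \o @tcons _ _ n)) => //.
- exact: measurable_map_tuple.
- by rewrite exprn_ge0.
- by apply: measurableT_comp => //; exact: measurable_tcons.
- by move=> z; exact: f0.
Qed.

(** The event that coordinate [i] lies in [A] is a box whose other sides are full, so the [i]-th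
    marginal of the product law is [P]. *)
Lemma integral_iid_prob_tnth n (i : 'I_n) (g : X -> \bar R) :
  measurable_fun setT g -> (forall x, 0 <= g x) ->
  \int[iid_prob P n]_t g (tnth t i) = \int[P]_x g x.
Proof.
move=> mg g0; have mi := @measurable_tnth _ X n i.
rewrite -(@ge0_integral_pushforward _ _ _ _ _ _ mi (iid_prob P n) setT g)//.
apply: eq_measure_integral => A mA _; rewrite /= /pushforward.
rewrite (_ : _ @^-1` _ =
    [set t | forall j, (if j == i then A else setT) (tnth t j)]); last first.
  apply/seteqP; split=> t /=; first by move=> At j; case: eqP => [->|].
  by move=> /(_ i); rewrite eqxx.
rewrite (iid_probE P (A := fun j => if j == i then A else setT)); last first.
  by move=> j; case: ifP.
rewrite (bigD1 i)//= eqxx big1 ?mule1// => j /negbTE ->.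
exact: probability_setT.
Qed.

End iid.

Section gaussian_shear.
Context {R : realType}.
Local Notation mR := (measurableTypeR R).
Local Notation gauss := (normal_prob (0 : R) 1).

(** Cauchy-Schwarz against the likelihood ratio of the shift by [s]: its square is [expR (s ^+ 2)]
    times the likelihood ratio of the shift by [2 * s], which has integral 1. *)
Lemma chi2_le_gauss (s : R) : chi2_le gauss (fun x : mR => (x + s)%R) (expR (s ^+ 2)).
Proof.
move=> f mf f0; rewrite integral_gauss_shift//.
have mL (r : R) : measurable_fun setT (fun x : mR => expR (r * x - r ^+ 2 / 2) : mR).
  by apply: measurableT_comp => //; apply: measurable_funB => //;
    exact: measurable_funM.
have mLE (r : R) : measurable_fun setT
    (fun x : mR => (expR (r * x - r ^+ 2 / 2))%:E).
  by apply/measurable_EFinP; exact: mL.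
pose u (x : mR) := (expR (s * x - s ^+ 2 / 2) * expR (s * x - s ^+ 2 / 2))%R.
apply: (@integral_sqr_le _ _ _ _ u); rewrite ?expR_gt0//.
- exact: (measurable_funM (mL s) (mL s)).
- exact: emeasurable_funM.
- exact: (emeasurable_funM mf (mLE s)).
- by move=> x; rewrite mulr_ge0// expR_ge0.
- by move=> x; rewrite mule_ge0.
- by move=> x; rewrite mule_ge0// lee_fin expR_ge0.
- by move=> x; rewrite /u EFinM muleACA muleC.
rewrite (eq_integral (fun x : mR =>
  (expR (s ^+ 2))%:E * (expR (2 * s * x - (2 * s) ^+ 2 / 2))%:E)); last first.
  by move=> x _; rewrite /u -EFinM -!expRD; congr ((expR _)%:E); field.
have E0 (r : R) : 0 <= (expR r)%:E by rewrite lee_fin expR_ge0.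
by rewrite ge0_integralZl// integral_gauss_expR mule1.
Qed.

(** Given [a], the shear is a Gaussian shift by [b * a_i], with constant [expR ((b * a_i) ^+ 2)].
    Cauchy-Schwarz over [a] then replaces this constant by its Gaussian mean, controlled by
    [integral_gauss_expR_sqr] at [c = b ^+ 2]. *)
Lemma chi2_le_shear n (i : 'I_n) (b : R) : (b ^+ 2 <= 4^-1)%R ->
  chi2_le (iid_prob gauss n \x gauss)
    (fun z : n.-tuple mR * mR => (z.1, (z.2 + b * tnth z.1 i)%R))
    (expR (2 * b ^+ 2)).
Proof.
move=> b4 f mf f0.
have mt : measurable_fun setT (fun a : n.-tuple mR => tnth a i).
  exact: measurable_tnth.
have mT : measurable_fun setT
    (fun z : n.-tuple mR * mR => (z.1, (z.2 + b * tnth z.1 i)%R : mR)).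
  apply/measurable_fun_pair => //=; apply: measurable_funD => //.
  by apply: measurable_funM => //; exact: (measurableT_comp mt measurable_fst).
pose k (z : n.-tuple mR * mR) := f (z.1, (z.2 + b * tnth z.1 i)%R : mR).
have mk : measurable_fun setT k by exact: measurableT_comp.
have k0 z : 0 <= k z by exact: f0.
have mff : measurable_fun setT (fun z => f z * f z) by exact: emeasurable_funM.
have ff0 z : 0 <= f z * f z by rewrite mule_ge0.
rewrite -[leLHS]/((\int[_]_z k z) * (\int[_]_z k z)) !fubini_tonelli1//.
apply: (@integral_sqr_le _ (n.-tuple mR) R (iid_prob gauss n)
    (fun a : n.-tuple mR => expR ((b * tnth a i) ^+ 2))
    (fun a => \int[gauss]_x (f (a, x) * f (a, x)))
    (fun a => \int[gauss]_x k (a, x))); rewrite ?expR_gt0//.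
- by apply: measurableT_comp => //; apply: measurable_funX;
    exact: measurable_funM.
- exact: (@measurable_integral_section _ _ _ mR _ gauss (fun z => f z * f z)).
- exact: (@measurable_integral_section _ _ _ mR _ gauss k).
- by move=> a; apply: integral_ge0.
- by move=> a; apply: integral_ge0 => x _; exact: f0.
- move=> a; apply: (@chi2_le_gauss (b * tnth a i) (fun x => f (a, x))) => //.
  by apply: measurableT_comp => //; exact: pair1_measurable.
have me : measurable_fun setT (fun x : mR => (expR ((b * x) ^+ 2))%:E).
  apply/measurable_EFinP; apply: measurableT_comp => //.
  by apply: measurable_funX; exact: measurable_funM.
have e0 (x : mR) : 0 <= (expR ((b * x) ^+ 2))%:E by rewrite lee_fin expR_ge0.
have -> := @integral_iid_prob_tnth _ mR R gauss n i _ me e0.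
under eq_integral do rewrite exprMn.
by apply: integral_gauss_expR_sqr; rewrite sqr_ge0.
Qed.

End gaussian_shear.

End chi_square.

(** * The law of the observations under a one-coordinate change of parameter *)

Section observation_law.
Context {R : realType}.
Local Notation mR := (measurableTypeR R).
Local Notation gauss := (normal_prob (0 : R) 1).

Lemma measurable_inner d (v : 'cV[R]_d) :
  measurable_fun setT (fun a : d.-tuple mR => inner a v : mR).
Proof.
apply: (@measurable_sum _ _ _ setT _ _ (fun i (a : d.-tuple mR) => tnth a i * v i 0)).
move=> i; apply: measurable_funM => //; exact: measurable_tnth.
Qed.

Lemma measurable_sgr : measurable_fun setT (Num.sg : mR -> mR).
Proof.
rewrite (_ : Num.sg = fun x : mR => \1_`]0%R, +oo[%classic x - \1_`]-oo, 0%R[%classic x); last first.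
  apply/funext => x; rewrite !indicE !mem_setE !in_itv/= andbT.
  have [x0|x0|->] := ltgtP x 0.
  - by rewrite ltr0_sg// sub0r.
  - by rewrite gtr0_sg// subr0.
  - by rewrite sgr0 subrr.
by apply: measurable_funB; exact: measurable_indic.
Qed.

Lemma measurable_observe d (v : 'cV[R]_d) : measurable_fun setT (@observe R d v).
Proof.
rewrite (_ : @observe R d v = fun w : d.-tuple mR * mR * mR =>
    (w.1.1, Num.sg (inner w.1.1 v + w.1.2 + w.2) : mR)); last first.
  by apply/funext => -[[a xi] tau].
have m11 : measurable_fun setT (fun w : d.-tuple mR * mR * mR => w.1.1).
  exact: measurableT_comp.
have m12 : measurable_fun setT (fun w : d.-tuple mR * mR * mR => w.1.2).
  exact: measurableT_comp.
apply/measurable_fun_pair => //; apply: (measurableT_comp measurable_sgr).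
apply: measurable_funD => //; apply: measurable_funD => //.
exact: (measurableT_comp (measurable_inner v) m11).
Qed.

Lemma observationsE d m (v : 'cV[R]_d) :
  @observations R d m v = @map_tuple m _ _ (observe v).
Proof.
by apply/funext => w; apply: eq_from_tnth => i; rewrite tnth_mktuple tnth_map.
Qed.

Lemma measurable_observations d m (v : 'cV[R]_d) :
  measurable_fun setT (@observations R d m v).
Proof.
apply/measurable_fun_tnthP => i.
rewrite (_ : _ \o _ = observe v \o (@tnth m _ ^~ i)).
  by apply: measurableT_comp; [exact: measurable_observe|exact: measurable_tnth].
by apply/funext => w /=; rewrite tnth_mktuple.
Qed.

Definition shear d (i : 'I_d) (b : R) (w : d.-tuple mR * mR * mR) :
    d.-tuple mR * mR * mR :=
  ((w.1.1, (w.1.2 + b * tnth w.1.1 i)%R), w.2).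

Lemma measurable_shear d (i : 'I_d) (b : R) : measurable_fun setT (shear i b).
Proof.
have mt : measurable_fun setT (fun a : d.-tuple mR => tnth a i).
  exact: measurable_tnth.
have m11 : measurable_fun setT (fun w : d.-tuple mR * mR * mR => w.1.1).
  exact: measurableT_comp.
have m12 : measurable_fun setT (fun w : d.-tuple mR * mR * mR => w.1.2).
  exact: measurableT_comp.
apply/measurable_fun_pair => //; apply/measurable_fun_pair => //.
apply: measurable_funD => //; apply: measurable_funM => //.
exact: (measurableT_comp mt m11).
Qed.

(** The term [b * a_i] can be charged to the parameter or to the noise. Both observation laws are
    thus images under the single map [observe v], which is what data processing requires. *)
Lemma observe_shear d (i : 'I_d) (b : R) (v : 'cV[R]_d) :
  observe (v + b *: delta_mx i 0) =1 observe v \o shear i b.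
Proof.
move=> [[a xi] tau]; rewrite /observe /shear/=; congr (_, Num.sg (_ + _)).
suff -> : inner a (v + b *: delta_mx i 0) = inner a v + b * tnth a i.
  by rewrite -addrA; congr (_ + _); rewrite addrC.
rewrite /inner; under eq_bigr do rewrite !mxE mulrDr.
rewrite big_split/=; congr (_ + _); rewrite (bigD1 i)//= eqxx mulr1 mulrC.
by rewrite big1 ?addr0// => j /negbTE ->; rewrite !mulr0.
Qed.

(** The dithering [tau] is an independent factor on which the shear acts as the identity, so it
    contributes the constant 1 for every [lambda]. *)
Lemma chi2_le_noise d (lambda : R) (lambda0 : 0 < lambda) (i : 'I_d) (b : R) :
  b ^+ 2 <= 4^-1 ->
  chi2_le (noise_prob d lambda0) (shear i b) (expR (2 * b ^+ 2)).
Proof.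
move=> b4; rewrite -[expR _]mulr1.
have mt : measurable_fun setT (fun a : d.-tuple mR => tnth a i).
  exact: measurable_tnth.
apply: (chi2_le_prod (S := fun z : d.-tuple mR * mR => (z.1, z.2 + b * tnth z.1 i)) (T := id)) => //.
- apply/measurable_fun_pair => //; apply: measurable_funD => //.
  by apply: measurable_funM => //; exact: (measurableT_comp mt measurable_fst).
- exact: chi2_le_shear.
- exact: chi2_le_id.
Qed.

Definition obs_prob d m (lambda : R) (lambda0 : 0 < lambda) (v : 'cV[R]_d)
    (A : set (m.-tuple (d.-tuple mR * mR))) : R :=
  fine (iid_prob (noise_prob d lambda0) m (observations v @^-1` A)).

(** Data processing: the chi-square bound is tested on the indicator of the preimage of [A] under
    [observations v]; an indicator equals its square, so both integrals are probabilities. *)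
Lemma obs_prob_sqr_le d m (lambda : R) (lambda0 : 0 < lambda) (i : 'I_d)
    (b : R) (v : 'cV[R]_d) (A : set (m.-tuple (d.-tuple mR * mR))) :
  b ^+ 2 <= 4^-1 -> measurable A ->
  obs_prob lambda0 (v + b *: delta_mx i 0) A ^+ 2 <=
    expR (2 * b ^+ 2) ^+ m * obs_prob lambda0 v A.
Proof.
move=> b4 mA; rewrite /obs_prob; set P := iid_prob _ _.
pose B := observations v @^-1` A.
have mB : measurable B.
  by rewrite -[B]setTI; exact: (@measurable_observations d m v measurableT A mA).
pose T := @map_tuple m _ _ (@shear d i b).
have mT : measurable_fun setT T.
  exact: (@measurable_map_tuple _ _ m _ (@measurable_shear d i b)).
have -> : observations (v + b *: delta_mx i 0) = observations v \o T.
  apply/funext => w; rewrite /= !observationsE; apply: eq_from_tnth => j.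
  by rewrite !tnth_map observe_shear.
rewrite -[_ @^-1` A]/(T @^-1` B).
have mTB : measurable (T @^-1` B) by rewrite -[_ @^-1` _]setTI; exact: (mT measurableT B mB).
have PB C : measurable C -> P C = (\int[P]_x (\1_C x)%:E)%E.
  by move=> mC; rewrite integral_indic// setIT.
have m1 : measurable_fun setT (fun x => (\1_B x)%:E : \bar R).
  by apply/measurable_EFinP; exact: (@measurable_indic _ _ R setT B mB).
have i0 x : (0 <= (\1_B x)%:E :> \bar R)%E by rewrite lee_fin.
have := chi2_le_iid (n := m) (@measurable_shear d i b) (expR_ge0 _)
  (chi2_le_noise lambda0 i b4) m1 i0.
have -> : (\int[P]_x (\1_B (map_tuple (shear i b) x))%:E =
    P (T @^-1` B))%E.
  by rewrite PB.
under eq_integral do rewrite -EFinM -[(_ * _)%R]/((\1_B \* \1_B) _) -indicI setIid.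
have PF C : measurable C -> P C = (fine (P C))%:E.
  by move=> mC; rewrite fineK// fin_num_measure.
by rewrite -/P -PB// -/B (PF B)// (PF (T @^-1` B))// -!EFinM lee_fin expr2.
Qed.

End observation_law.

(** * Block-sparse signals and the error caused by wrongly decoded blocks *)

Section sparse_signal.
Context {R : realType} {k q d : nat}.
Variable pos : 'I_k -> 'I_q -> 'I_d.
Hypothesis pos_inj : injective (fun p : 'I_k * 'I_q => pos p.1 p.2).

Definition sparse_signal (b : R) (I : 'I_k -> 'I_q) : 'cV[R]_d :=
  \sum_j b *: delta_mx (pos j (I j)) 0.

Lemma sparse_signalE b I j i :
  sparse_signal b I (pos j i) 0 = b * (i == I j)%:R.
Proof.
have posE j' i' : (pos j i == pos j' i') = (j == j') && (i == i').
  by rewrite -xpair_eqE -(inj_eq pos_inj).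
rewrite summxE (bigD1 j)//= !mxE posE !eqxx andbT/= big1 ?addr0// => j' jj'.
by rewrite !mxE posE eq_sym (negbTE jj') mulr0.
Qed.

Lemma sum_pos_le (F : 'I_d -> R) : (forall r, 0 <= F r) ->
  \sum_j \sum_i F (pos j i) <= \sum_r F r.
Proof.
move=> F0; rewrite pair_big/=.
rewrite -(big_imset (h := fun p : 'I_k * 'I_q => pos p.1 p.2) F) /=; last first.
  by move=> x y _ _; exact: pos_inj.
rewrite [leRHS](bigID (mem ((fun p : 'I_k * 'I_q => pos p.1 p.2) @: predT)))/=.
by rewrite lerDl sumr_ge0.
Qed.

(** In each block of [E] some coordinate of [v] is on the wrong side of [b / 2], which costs at
    least [(b / 2) ^+ 2]. With [N] such blocks, [N <= k] gives [N ^+ 2 / k <= N], hence a bound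
    linear in the indicators and easy to integrate. *)
Lemma norm2_ge (b : R) (I : 'I_k -> 'I_q) (E : {pred 'I_k}) (v : 'cV[R]_d) :
  0 <= b ->
  (forall j, j \in E -> exists i, (b / 2 < v (pos j i) 0) != (i == I j)) ->
  b / 2 / Num.sqrt k%:R * \sum_j (j \in E)%:R <= norm2 (v - sparse_signal b I).
Proof.
move=> b0 wrong; set N := \sum_j _.
have N0 : 0 <= N by rewrite sumr_ge0.
have Nk : N <= k%:R.
  rewrite -[X in _ <= X%:R]card_ord -sumr_const ler_sum// => j _.
  by case: (_ \in _).
set s := Num.sqrt k%:R.
have s0 : 0 <= s by rewrite sqrtr_ge0.
have ss : s ^+ 2 = k%:R by rewrite sqr_sqrtr.
have sumE : (b / 2) ^+ 2 * N <= \sum_r (v - sparse_signal b I) r 0 ^+ 2.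
  apply: le_trans (sum_pos_le (F := fun r => _ r 0 ^+ 2) _); last first.
    by move=> r; rewrite sqr_ge0.
  rewrite mulr_sumr ler_sum// => j _; case: (boolP (j \in E)) => [jE|_]; last first.
    by rewrite mulr0 sumr_ge0// => i _; rewrite sqr_ge0.
  have [i vi] := wrong j jE.
  rewrite mulr1 (bigD1 i)//= ler_wpDr ?sumr_ge0//.
    by move=> i' _; rewrite sqr_ge0.
  rewrite mxE [in leRHS]mxE sparse_signalE; move: vi.
  case: (i == I j); case: ltP => //= vb _.
    by nra.
  by rewrite mulr0 subr0; nra.
apply: le_trans (ler_wsqrtr sumE).
(* For [k = 0] the convention [0^-1 = 0] makes the left side vanish. *)
have [s00|sn0] := eqVneq s 0.
  by rewrite s00 invr0 mulr0 mul0r sqrtr_ge0.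
have x0 : 0 <= b / 2 / s * N.
  by rewrite mulr_ge0// divr_ge0// divr_ge0.
rewrite -[leLHS](ger0_norm x0) -sqrtr_sqr ler_wsqrtr//.
rewrite exprMn expr_div_n ss -mulrA ler_wpM2l ?sqr_ge0//.
have k0 : 0 < k%:R :> R by rewrite -ss exprn_gt0// lt_neqAle eq_sym sn0.
by rewrite mulrC ler_pdivrMr// expr2 ler_wpM2l.
Qed.

End sparse_signal.

(** For a uniform random [f], the value [f j] is independent of the other values. Concretely,
    exchanging [f j] with a free index [i] is an involution on pairs [(f, i)], and [G] does not see
    the change in [f]. *)
Lemma sum_ffun_resample (I J : finType) (V : nmodType) (j : I)
    (G : {ffun I -> J} -> J -> V) :
  (forall (f : {ffun I -> J}) i, G [ffun x => if x == j then i else f x] = G f) ->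
  (\sum_f G f (f j)) *+ #|J| = \sum_f \sum_i G f i.
Proof.
move=> Gu; pose upd (f : {ffun I -> J}) i := [ffun x => if x == j then i else f x].
pose phi (p : {ffun I -> J} * J) := (upd p.1 p.2, p.1 j).
have phiK : involutive phi.
  move=> [f i]; rewrite /phi/=; congr (_, _); last by rewrite ffunE eqxx.
  by apply/ffunP => x; rewrite !ffunE; case: eqP => [->|].
rewrite pair_big/= (reindex_inj (inv_inj phiK))/=.
under [RHS]eq_bigr do rewrite Gu.
rewrite -(pair_big predT predT (fun f _ => G f (f j)))/=.
by rewrite -sumrMnl; apply: eq_bigr => f _; rewrite sumr_const.
Qed.

(** * Assouad's reduction: the average number of wrongly decoded blocks *)

Section assouad.
Context {R : realType} {k q d : nat}.
Local Notation mR := (measurableTypeR R).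
Variable pos : 'I_k -> 'I_q -> 'I_d.
Hypothesis pos_inj : injective (fun p : 'I_k * 'I_q => pos p.1 p.2).
Variables (m : nat) (lambda : R) (lambda0 : 0 < lambda).
Variable est : m.-tuple (d.-tuple mR * mR) -> 'cV[R]_d.
Hypothesis mest : estimator est.
Variable b : R.
Hypothesis b0 : 0 < b.
Hypothesis b4 : b ^+ 2 <= 4^-1.

Let P := iid_prob (noise_prob d lambda0) m.

(* Thresholding the estimate at b / 2 decodes block j as i. *)
Let decoded (j : 'I_k) (i : 'I_q) : set (m.-tuple (d.-tuple mR * mR)) :=
  [set s | forall i', (b / 2 < est s (pos j i') 0) = (i' == i)].

Let measurable_decoded j i : measurable (decoded j i).
Proof.
rewrite (_ : decoded j i = \bigcap_(i' in [set: 'I_q])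
  ((fun s => est s (pos j i') 0 : mR) @^-1`
    (if i' == i then `]b / 2, +oo[%classic else `]-oo, b / 2]%classic))); last first.
  apply/seteqP; split=> s /=.
    move=> dec i' _; have := dec i'.
    by case: eqP => _ /= decE; rewrite in_itv/= ?andbT ?leNgt decE.
  move=> dec i'; have := dec i' Logic.I.
  by case: eqP => _ /=; rewrite in_itv/= ?andbT// leNgt => /negbTE.
apply: fin_bigcap_measurable => // i' _.
rewrite -[X in measurable X]setTI; apply: mest => //.
by case: ifP.
Qed.

Let measurable_decoded_obs v j i :
  measurable (@observations R d m v @^-1` decoded j i).
Proof.
rewrite -[_ @^-1` _]setTI.
exact: (@measurable_observations R d m v measurableT _ (measurable_decoded j i)).
Qed.

Let sum_decoded_le1 (v : 'cV[R]_d) j : \sum_i obs_prob lambda0 v (decoded j i) <= 1.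
Proof.
rewrite -lee_fin -sumEFin.
under eq_bigr do rewrite fineK ?fin_num_measure//.
rewrite -measure_bigsetU_ord//.
  by apply: probability_le1; apply: bigsetU_measurable.
apply/trivIsetP => i i' _ _ ii'; apply/seteqP; split=> // w [/= Di Di'].
by have := Di' i; rewrite (Di i) eqxx (negbTE ii').
Qed.

(** [norm2_ge] holds for every outcome with [E] the set of wrongly decoded blocks; integrating turns
    indicators into error probabilities. *)
Lemma risk_ge (I : 'I_k -> 'I_q) :
  ((b / 2 / Num.sqrt k%:R * \sum_j (1 - obs_prob lambda0 (sparse_signal pos b I)
      (decoded j (I j))))%:E <=
   risk lambda0 est (sparse_signal pos b I))%E.
Proof.
set v := sparse_signal pos b I.
pose B j := observations v @^-1` decoded j (I j).
have mB j : measurable (~` B j) by apply: measurableC; exact: measurable_decoded_obs.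
have c0 : 0 <= b / 2 / Num.sqrt k%:R by rewrite !divr_ge0// ltW.
have m1 j : measurable_fun setT (fun w => (\1_(~` B j) w)%:E : \bar R).
  by apply/measurable_EFinP; exact: (@measurable_indic _ _ R setT _ (mB j)).
have i0 j w : setT w -> (0 <= (\1_(~` B j) w)%:E :> \bar R)%E by rewrite lee_fin.
rewrite (_ : _%:E = \int[P]_w ((b / 2 / Num.sqrt k%:R)%:E *
    \sum_j (\1_(~` B j) w)%:E))%E; last first.
  rewrite ge0_integralZl//; first last.
  - by move=> w _; apply: sume_ge0 => j _; exact: i0.
  - exact: emeasurable_sum.
  rewrite ge0_integral_sum// EFinM -sumEFin; congr (_ * _)%E; apply: eq_bigr => j _.
  rewrite integral_indic// setIT [RHS]probability_setC; last exact: measurable_decoded_obs.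
  by rewrite EFinB fineK// fin_num_measure//; exact: measurable_decoded_obs.
rewrite /risk; apply: ge0_le_integral => //.
- move=> w _; rewrite mule_ge0//; apply: sume_ge0 => j _; exact: i0.
- by apply: measurable_funeM; exact: emeasurable_sum.
- apply/measurable_EFinP; apply: (measurableT_comp
    (continuous_measurable_fun (@sqrt_continuous R))).
  apply: measurable_sum => r; apply: measurable_funX.
  under eq_fun do rewrite mxE.
  apply: measurable_funD => //.
  exact: (measurableT_comp (mest r) (@measurable_observations R d m v)).
- move=> w _; rewrite sumEFin -EFinM lee_fin.
  pose E := [pred j | w \in ~` B j].
  apply: le_trans (norm2_ge pos_inj (I := I) (E := E) (ltW b0) _).
    by [].
  move=> j; rewrite -topredE/= => /set_mem /existsNP[i Bi]; exists i.
  by apply/eqP.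
Qed.

Variable rho : R.
Hypothesis rho0 : 0 < rho.
Hypothesis rhoE : expR (2 * b ^+ 2) ^+ m <= rho ^+ 2 * q%:R.

(** With block [j] emptied, the reference law [ref I] does not depend on [I j], and the decoding
    events for distinct indices are disjoint, so [q * G I (I j)] has mean at most 1 over [I]. The
    chi-square bound transfers this to the true signal. *)
Let sum_success_le (j : 'I_k) :
  \sum_(I : {ffun 'I_k -> 'I_q})
    obs_prob lambda0 (sparse_signal pos b I) (decoded j (I j)) <=
  #|{ffun 'I_k -> 'I_q}|%:R * rho.
Proof.
pose ref (I : 'I_k -> 'I_q) : 'cV[R]_d :=
  \sum_(j' | j' != j) b *: delta_mx (pos j' (I j')) 0.
pose G I i := obs_prob lambda0 (ref I) (decoded j i).
have success_le I : obs_prob lambda0 (sparse_signal pos b I) (decoded j (I j)) <=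
    2^-1 * (rho + rho * (q%:R * G I (I j))).
  have := obs_prob_sqr_le lambda0 (pos j (I j)) (ref I) b4
    (measurable_decoded j (I j)).
  rewrite -[ref I + _](_ : sparse_signal pos b I = _); last first.
    by rewrite addrC /sparse_signal (bigD1 j).
  set p := obs_prob _ _ _; rewrite -/(G I (I j)) => pG.
  have G0 : 0 <= G I (I j) by rewrite fine_ge0.
  have pG' := le_trans pG (ler_wpM2r G0 rhoE).
  rewrite -(ler_pM2r rho0).
  (* For the success probability [p], [rho * p <= (rho ^+ 2 + p ^+ 2) / 2] linearises the square
     root of Cauchy-Schwarz, so that averaging over [I] is possible. *)
  by have := sqr_ge0 (rho - p); nra.
have GS : (\sum_(I : {ffun 'I_k -> 'I_q}) G I (I j)) *+ q <=
    #|{ffun 'I_k -> 'I_q}|%:R.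
  have := @sum_ffun_resample 'I_k 'I_q R j (fun I : {ffun 'I_k -> 'I_q} => G I).
  rewrite card_ord => ->; last first.
    move=> f i; apply/funext => i'; rewrite /G (_ : ref _ = ref f)//.
    by rewrite /ref; apply: eq_bigr => j' /negbTE jj'; rewrite ffunE jj'.
  by rewrite -sumr_const ler_sum// => I _; exact: sum_decoded_le1.
apply: le_trans; first by apply: ler_sum => I _; exact: success_le.
rewrite -mulr_sumr big_split/= sumr_const -!mulr_sumr -[_ *+ _]mulr_natl.
rewrite -mulr_natl -(ler_pM2l rho0) in GS.
by move: GS; lra.
Qed.

Lemma exists_risk_ge : (0 < q)%N -> exists I : {ffun 'I_k -> 'I_q},
  ((b / 2 * Num.sqrt k%:R * (1 - rho))%:E <=
    risk lambda0 est (sparse_signal pos b I))%E.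
Proof.
move=> q0; apply: contrapT => /forallNP noI.
pose r (I : {ffun 'I_k -> 'I_q}) := b / 2 / Num.sqrt k%:R *
  \sum_j (1 - obs_prob lambda0 (sparse_signal pos b I) (decoded j (I j))).
have rlt I : r I < b / 2 * Num.sqrt k%:R * (1 - rho).
  rewrite ltNge; apply/negP => rI; apply: (noI I).
  by apply: le_trans (risk_ge I); rewrite lee_fin.
have : \sum_I r I < \sum_(I : {ffun 'I_k -> 'I_q}) b / 2 * Num.sqrt k%:R * (1 - rho).
  (* Strictness of the summed inequality requires some index [I]; [q > 0] provides a constant
     one. *)
  apply: ltr_sum => //; apply/hasP; by exists [ffun=> Ordinal q0].
apply/negP; rewrite -leNgt sumr_const -mulr_sumr exchange_big/= -[leLHS]mulr_natl.
have -> : #|{ffun 'I_k -> 'I_q}|%:R * (b / 2 * Num.sqrt k%:R * (1 - rho)) =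
    b / 2 / Num.sqrt k%:R *
      \sum_(j < k) (#|{ffun 'I_k -> 'I_q}|%:R * (1 - rho)).
  rewrite sumr_const card_ord -[X in _ = _ * X]mulr_natl.
  rewrite -[X in _ = _ * (X * _)](sqr_sqrtr (ler0n R k)).
  have [->|s0] := eqVneq (Num.sqrt (k%:R : R)) 0; last by field.
  by rewrite expr0n/= !(mul0r, mulr0).
rewrite ler_wpM2l ?divr_ge0 ?(ltW b0)//; apply: ler_sum => j _.
rewrite big_split/= sumr_const sumrN mulrBr mulr1 lerD2l lerN2.
exact: sum_success_le.
Qed.

End assouad.

(** * The ReLU network whose range contains the sparse signals *)

Section sparse_network.
Context {R : realType} (k q d : nat).
Hypothesis k0 : (0 < k)%N.
Hypothesis qd : (q.+2 * k <= d)%N.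

Lemma interleave_subproof (j : 'I_k) (i : 'I_q) : (i * k + j < d)%N.
Proof.
apply: (@leq_trans (i.+1 * k)); first by rewrite mulSn addnC ltn_add2r.
by apply: leq_trans qd; rewrite leq_mul2r (leq_trans (ltn_ord i)) ?orbT// leqW.
Qed.

(** Block [j] is the residue class of [j] modulo [k], so consecutive indices of a block are [k]
    coordinates apart. *)
Definition interleave (j : 'I_k) (i : 'I_q) : 'I_d :=
  Ordinal (interleave_subproof j i).

Lemma interleave_div j i : (interleave j i %/ k = i)%N.
Proof. by rewrite /= divnMDl// divn_small ?addn0. Qed.

Lemma interleave_mod j i : (interleave j i %% k = j)%N.
Proof. by rewrite /= modnMDl modn_small. Qed.

Lemma interleave_inj : injective (fun p : 'I_k * 'I_q => interleave p.1 p.2).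
Proof.
move=> [j i] [j' i'] /= e; congr (_, _); apply/val_inj => /=.
  by rewrite -(interleave_mod j i) e interleave_mod.
by rewrite -(interleave_div j i) e interleave_div.
Qed.

Lemma sum_delta (n p : nat) (F : nat -> R) : (p < n)%N ->
  \sum_(c < n) (c == p :> nat)%:R * F c = F p.
Proof.
move=> pn; rewrite (bigD1 (Ordinal pn))//= eqxx mul1r big1 ?addr0// => c.
by rewrite -val_eqE => /negbTE /= ->; rewrite mul0r.
Qed.

(** Truncated subtraction of naturals is the ramp function on the grid, so the first layer can be
    evaluated in [nat]. *)
Lemma relu_natB (b : R) (n p : nat) : 0 <= b ->
  relu (b * (n%:R - p%:R)) = b * (n - p)%N%:R.
Proof.
move=> b0; rewrite /relu; have [pn|/ltnW np] := leqP p n.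
  by rewrite natrB// max_l// mulr_ge0// subr_ge0 ler_nat.
rewrite (eqP (_ : n - p == 0)%N) ?subn_eq0// mulr0 max_r//.
by rewrite mulr_ge0_le0// subr_le0 ler_nat.
Qed.

(** A second difference of the ramp: for [p < n] the three values are in arithmetic progression, for
    [p > n] all vanish, and at [p = n] they are [b, 0, 0]. *)
Lemma relu_tent (b : R) (n p : nat) : 0 <= b ->
  relu (b * (n.+1 - p)%:R - 2 * (b * (n.+1 - p.+1)%:R)
    + b * (n.+1 - p.+2)%:R) = b * (p == n)%:R.
Proof.
move=> b0; rewrite /relu !subSS; have [pn|np|->] := ltngtP p n.
- rewrite subSn ?(ltnW pn)// -(subnSK pn) mulr0; set t := (n - p.+1)%N.
  have -> : b * t.+2%:R - 2 * (b * t.+1%:R) + b * t%:R = 0.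
    by rewrite -(@natr1 _ t.+1) -(@natr1 _ t); ring.
  exact: maxxx.
- have [e0 e1 e2] : [/\ n.+1 - p = 0, n - p = 0 & n - p.+1 = 0]%N.
    by split; apply/eqP; rewrite subn_eq0// ltnW// ltnW.
  by rewrite e0 e1 e2 !mulr0 subrr addr0 maxxx.
- by rewrite subSnn subnn (eqP (_ : n - n.+1 == 0)%N)
    ?subn_eq0// !mulr0 subr0 addr0 mulr1 max_l.
Qed.

Definition ramp_weights : 'M[R]_(d, k.+1) :=
  \matrix_(r, c) ((c == (r %% k)%N :> nat)%:R - (r %/ k)%N%:R * (c == k :> nat)%:R).

(** Second differences along a block, whose step is [k]. Rows from [q * k] on are zero; for the
    others [r + 2 * k] stays below [q.+2 * k <= d]. *)
Definition tent_weights : 'M[R]_d :=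
  \matrix_(r, c) ((r < q * k)%N%:R *
    ((c == r :> nat)%:R - 2 * (c == (r + k)%N :> nat)%:R
      + (c == (r + k + k)%N :> nat)%:R)).

(* On block j the network computes the tents of width z centred at (i + 1) z,
   evaluated at x_j; the last input z plays the role of the missing offsets. *)
Definition sparse_network (x : 'cV[R]_k.+1) : 'cV[R]_d :=
  relu_layer tent_weights (relu_layer 1%:M (relu_layer ramp_weights x)).

Lemma relu_network3_sparse : relu_network3 sparse_network.
Proof. by exists d, d, ramp_weights, 1%:M, tent_weights. Qed.

Lemma sparse_signal_range (b : R) (I : 'I_k -> 'I_q) : 0 <= b ->
  range sparse_network (sparse_signal interleave b I).
Proof.
move=> b0.
(* The input has [b * (I j).+1] in block [j]; the default value 1, reached at [c = k], makes the
   last input equal to [b], the tent width. *)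
pose center (c : nat) := if insub c is Some j then (I j).+1 else 1%N.
pose ramp (r : nat) : R := b * (center (r %% k) - r %/ k)%N%:R.
exists (\col_c (b * (center c)%:R)) => //; rewrite /sparse_network.
have ramp0 r : 0 <= ramp r by rewrite mulr_ge0.
have -> : relu_layer ramp_weights (\col_c (b * (center c)%:R)) = \col_r ramp r.
  apply/colP => r; rewrite !mxE.
  under eq_bigr do rewrite !mxE mulrBl -mulrA.
  rewrite sumrB -mulr_sumr (sum_delta (fun c => b * (center c)%:R)); last first.
    by rewrite ltnS ltnW// ltn_pmod.
  rewrite (sum_delta (fun c => b * (center c)%:R))//.
  rewrite /center [X in _ - _ * (b * X%:R)](_ : _ = 1%N); last by rewrite insubF ?ltnn.
  rewrite mulr1 (mulrC _ b) -mulrBr; exact: relu_natB.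
(* The ramps are nonnegative, so the middle layer with identity weights leaves them unchanged. *)
have -> : relu_layer 1%:M (\col_r ramp r) = \col_r ramp r :> 'cV[R]_d.
  by rewrite /relu_layer mul1mx; apply/colP => r; rewrite !mxE /relu max_l.
apply/colP => r; rewrite !mxE.
under eq_bigr do rewrite !mxE -mulrA.
rewrite -mulr_sumr; case: ltnP => [rq|qr]; last first.
  rewrite mul0r /relu max_l// summxE big1// => j _; rewrite !mxE -val_eqE/=.
  rewrite (_ : (val r == _) = false) ?mulr0//.
  apply/negbTE; rewrite gtn_eqF//; apply: leq_trans qr.
  by rewrite (@leq_trans ((I j).+1 * k))// ?leq_mul2r ?ltn_ord ?orbT// mulSn addnC ltn_add2r.
have rkk : (r + k + k < d)%N.
  by apply: leq_trans qd; rewrite !mulSn -addnA addnC -addnA !ltn_add2l.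
have rk : (r + k < d)%N by rewrite (leq_ltn_trans _ rkk)// leq_addr.
under eq_bigr do rewrite mulrDl mulrBl -mulrA.
rewrite big_split sumrB/= -mulr_sumr !sum_delta//.
have riq : (r %/ k < q)%N by rewrite ltn_divLR.
pose j := Ordinal (ltn_pmod r k0); pose i := Ordinal riq.
have rE : r = interleave j i by apply/val_inj; rewrite /= -divn_eq.
rewrite [X in _ = sparse_signal _ _ _ X _]rE sparse_signalE; last first.
  exact: interleave_inj.
have divDk n : ((n + k) %/ k = (n %/ k).+1)%N.
  by rewrite divnDr ?dvdnn// divnn k0 addn1.
rewrite /ramp !modnDr !divDk mul1r.
have -> : center (r %% k)%N = (I j).+1 by rewrite /center (valK j).
rewrite -val_eqE/=.
exact: relu_tent.
Qed.

End sparse_network.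

(** * Norm of the signals and choice of the constants *)

Lemma norm2_sparse_signal (R : realType) (k q d : nat)
    (pos : 'I_k -> 'I_q -> 'I_d) (b : R) (I : 'I_k -> 'I_q) :
  injective (fun p : 'I_k * 'I_q => pos p.1 p.2) ->
  norm2 (sparse_signal pos b I) = Num.sqrt (b ^+ 2 * k%:R).
Proof.
move=> pos_inj; congr Num.sqrt; pose v := sparse_signal pos b I.
(* Expanding one of the two factors [v r 0] restricts the sum to the [k] support coordinates, where
   the other factor is [b]. *)
have -> : \sum_r v r 0 ^+ 2 =
    \sum_r \sum_j b * ((r == pos j (I j))%:R * v r 0).
  apply: eq_bigr => r _; rewrite expr2 {1}/v summxE mulr_suml.
  by apply: eq_bigr => j _; rewrite !mxE andbT mulrA.
rewrite exchange_big/= -[k in RHS]card_ord mulr_natr -sumr_const.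
apply: eq_bigr => j _; rewrite -mulr_sumr (bigD1 (pos j (I j)))//= eqxx mul1r.
rewrite big1 ?addr0; last by move=> r /negbTE ->; rewrite mul0r.
by rewrite /v sparse_signalE// eqxx mulr1 expr2.
Qed.

Lemma minimax_risk_sparse_ge (R : realType) (k q d m : nat)
    (pos : 'I_k -> 'I_q -> 'I_d) (lambda : R) (lambda0 : 0 < lambda)
    (b rho : R) (Theta : set 'cV[R]_d) :
  injective (fun p : 'I_k * 'I_q => pos p.1 p.2) -> (0 < q)%N ->
  0 < b -> b ^+ 2 <= 4^-1 -> 0 < rho ->
  expR (2 * b ^+ 2) ^+ m <= rho ^+ 2 * q%:R ->
  (forall I : 'I_k -> 'I_q, Theta (sparse_signal pos b I)) ->
  ((b / 2 * Num.sqrt k%:R * (1 - rho))%:E <= minimax_risk m lambda0 Theta)%E.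
Proof.
move=> pos_inj q0 b0 b4 rho0 rhoE ThetaI; apply: le_ereal_inf_tmp => _ [est mest <-].
have [I] := exists_risk_ge pos_inj lambda0 mest b0 b4 rho0 rhoE q0.
by move=> /le_trans; apply; apply: ereal_sup_ubound; exists (sparse_signal pos b I).
Qed.

(** [d / k <= q + 3 <= q ^ 3] as soon as [q >= 2]. *)
Lemma ln_ratio_le (R : realType) (k d q : nat) : (0 < k)%N -> (1 < q)%N ->
  (d <= q.+3 * k)%N -> (0 < d)%N -> ln (d%:R / k%:R) <= 3 * ln q%:R :> R.
Proof.
move=> k0 q1 dq d0.
have q0 : (0 < q)%N by rewrite ltnW.
have kR : 0 < k%:R :> R by rewrite ltr0n.
have -> : 3 * ln q%:R = ln (q ^ 3)%N%:R :> R.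
  by rewrite natrX lnXn ?ltr0n// mulr_natl.
rewrite ler_ln ?posrE ?divr_gt0 ?ltr0n ?expn_gt0 ?q0//.
rewrite ler_pdivrMr// -natrM ler_nat (leq_trans dq)// leq_mul2r orbC.
suff -> : (q.+3 <= q ^ 3)%N by [].
rewrite !expnS expn0 muln1; case: q q1 {dq q0} => [|[|q]]// _.
by nia.
Qed.

Theorem corollary3p5 (R : realType) :
  exists c1 c2 : R, [/\ 0 < c1, 0 < c2 &
    forall k d : nat, (0 < k)%N -> (4 * k <= d)%N ->
    exists2 G : 'cV[R]_k.+1 -> 'cV[R]_d, relu_network3 G &
      forall (lambda : R) (lambda0 : 0 < lambda) (m : nat),
        c1 * (k%:R * ln (d%:R / k%:R)) <= m%:R ->
        ((c2 * Num.sqrt (k%:R * ln (d%:R / k%:R) / m%:R))%:E <=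
           minimax_risk m lambda0 (range G `&` @unit_ball2 R d))%E].
Proof.
(* With [rho = 9/10] the risk is at least [b * sqrt k / 20], while the target rate is
   [sqrt 12 * b * sqrt k <= 4 * b * sqrt k]; hence [c2 = 1/80]. *)
exists 1, 80^-1; split=> // k d k0 kd.
pose q := (d %/ k - 2)%N.
have q2 : (d %/ k = q.+2)%N by rewrite -addn2 subnK// (@leq_trans 4)// leq_divRL.
have q1 : (1 < q)%N by rewrite -(ltn_add2r 2) [(q + 2)%N]addn2 -q2 leq_divRL.
have qd : (q.+2 * k <= d)%N by rewrite -q2 leq_trunc_div.
have dq : (d <= q.+3 * k)%N by rewrite -q2 ltnW// ltn_ceil.
have d0 : (0 < d)%N by rewrite (leq_trans _ kd)// muln_gt0.
have kR : 1 <= k%:R :> R by rewrite ler1n.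
have kR0 : 0 < k%:R :> R by rewrite ltr0n.
exists (@sparse_network R k q d); first exact: relu_network3_sparse.
move=> lambda lambda0 m; rewrite mul1r; set L := ln _ => kLm.
have L0 : 0 < L.
  rewrite ln_gt0// ltr_pdivlMr// mul1r ltr_nat (leq_trans _ kd)//.
  by rewrite -[X in (X < _)%N]mul1n ltn_mul2r k0.
have Lq : L <= 3 * ln q%:R by exact: ln_ratio_le.
have m0 : 0 < m%:R :> R by rewrite (lt_le_trans _ kLm)// mulr_gt0.
(* The constant 12 makes [expR (2 * b ^+ 2) ^+ m = expR (L / 6)], at most [sqrt q] since
   [L <= 3 * ln q]. With [k * L <= m] it also gives [b ^+ 2 <= 1/4] and places the signals in the
   unit ball. *)
pose b := Num.sqrt (L / (12 * m%:R)).
have b2 : b ^+ 2 = L / (12 * m%:R) by rewrite sqr_sqrtr// divr_ge0 ?mulr_ge0// ltW.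
have b0 : 0 < b by rewrite sqrtr_gt0 divr_gt0// mulr_gt0.
have b4 : b ^+ 2 <= 4^-1.
  by rewrite b2 ler_pdivrMr ?mulr_gt0//; nra.
have expb : expR (2 * b ^+ 2) ^+ m <= (9 / 10) ^+ 2 * q%:R.
  have qR : 0 < q%:R :> R by rewrite ltr0n ltnW.
  have q2R : 2 <= q%:R :> R by rewrite ler_nat.
  pose z : R := Num.sqrt q%:R.
  have zz : z ^+ 2 = q%:R by rewrite sqr_sqrtr// ltW.
  have z0 : 0 <= z by rewrite sqrtr_ge0.
  (* [z <= (9/10)^2 * z^2] holds because [z ^+ 2 >= 2]; this is where [rho = 9/10] suffices. *)
  apply: (@le_trans _ _ z); last by rewrite -zz; nra.
  rewrite -(@ler_pXn2r _ 2)// ?nnegrE ?exprn_ge0 ?expR_ge0// zz.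
  rewrite -!expRM_natl -[leRHS]lnK ?posrE// ler_expR.
  have -> : 2 * (m%:R * (2 * b ^+ 2)) = L / 3.
    by rewrite b2; field; rewrite gt_eqF.
  by rewrite ler_pdivrMr// mulrC.
apply: le_trans (minimax_risk_sparse_ge (rho := 9 / 10) lambda0
  (@interleave_inj k q d k0 qd) (ltnW q1) b0 b4 _ expb _).
- rewrite lee_fin.
  have -> : k%:R * L / m%:R = 12 * (b ^+ 2 * k%:R).
    by rewrite b2; field; rewrite gt_eqF.
  rewrite sqrtrM// sqrtrM ?sqr_ge0// sqrtr_sqr gtr0_norm//.
  have s4 : Num.sqrt 12 <= 4 :> R.
    have -> : 4 = Num.sqrt (4 ^+ 2) :> R by rewrite sqrtr_sqr ger0_norm.
    by rewrite ler_wsqrtr// -natrX ler_nat.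
  have bk0 : 0 <= b * Num.sqrt k%:R by rewrite mulr_ge0 ?sqrtr_ge0 ?(ltW b0).
  by have := ler_wpM2r bk0 s4; lra.
- by lra.
- move=> I; split; first exact/sparse_signal_range/ltW.
  rewrite /unit_ball2/= norm2_sparse_signal; last exact: interleave_inj.
  rewrite -[leRHS]sqrtr1 ler_wsqrtr// b2 mulrAC ler_pdivrMr ?mulr_gt0// mul1r.
  by lra.
Qed.
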